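(* Let $n\ge1$, $\mathbf s\in\mathbb N^n$. For any two $\mathbf s$-arcs $\alpha,\alpha'$, the join irreducible $\mathbf s$-tree $\mathcal T_\vee(\alpha)$ forces $\mathcal T_\vee(\alpha')$ in the $\mathbf s$-weak order if and only if $\alpha$ is a subarc of $\alpha'$. That is, the forcing order on join irreducible $\mathbf s$-trees coincides with the subarc order on $\mathbf s$-arcs.
   Context: $[n]=\{1,\dots,n\}$, $]i,j[=\{i+1,\dots,j-1\}$, $\mathbf s=(s_1,\dots,s_n)$, $s_i\in\mathbb N$ (zeros allowed). An $\mathbf s$-tree is a rooted plane tree with internal nodes labeled bijectively by $[n]$, root with one child, node $j$ with $s_j+1$ ordered children each a leaf or a node $>j$. $\mathrm{pos}(\mathcal T,i,j)$ ($i<j$) = min of $s_i$ and the number of outgoing edges of $i$ strictly right of the path from the root to $j$. $\mathbf s$-weak order: $\mathcal T\le\mathcal T'$ iff $\mathrm{pos}(\mathcal T,i,j)\le\mathrm{pos}(\mathcal T',i,j)$ for all $i<j$; it is a finite lattice. Congruences and forcing: a congruence of a lattice $L$ is an equivalence relation with $x\equiv x',y\equiv y'\Rightarrow x\vee y\equiv x'\vee y'$ and $x\wedge y\equiv x'\wedge y'$. A join irreducible $j$ (covering a unique element $j_*$) is contracted by $\equiv$ if $j\equiv j_*$. For join irreducibles $j,j'$, $j$ forces $j'$ if every congruence contracting $j$ also contracts $j'$. $\mathbf s$-arcs: $(i,j,A,B,r)$ with $1\le i<j\le n$, $A\sqcup B=\{k\in]i,j[:s_k\ne0\}$, $r\in\{1,\dots,s_i\}$.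 Combs: the right $\mathbf s$-comb on $J\subseteq[n]$ is the increasing tree on $J$ where each $j\in J$ has $s_j+1$ outgoing edges, all leaves except the rightmost, which goes to the next element of $J$. $\mathcal T_\vee(i,j,A,B,r)$ is obtained from the right comb on $[n]\setminus(A\cup\{j\})$ by replacing the $(r+1)$-st outgoing edge of $i$ counted from the right (a leaf) by the right comb on $A\cup\{j\}$; these are exactly the join irreducible $\mathbf s$-trees. Subarcs: $\alpha=(i,j,A,B,r)$ is a subarc of $\alpha'=(i',j',A',B',r')$ if $i'\le i<j\le j'$; $A\subseteq A'$ and $B\subseteq B'$; if $s_j=0$ then $j=j'$; if $i'=i$ then $r=r'$; if $i'<i$ then either ($i\in A'$ and $r=1$) or ($i\in B'$ and $r=s_i$). *)

(* Defs.v *)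
From mathcomp Require Import all_boot.
Set Implicit Arguments.
Unset Strict Implicit.
Unset Printing Implicit Defensive.

(** * Forcing among join irreducibles of a lattice *)

(* The lattice is given by its order relation; joins and meets appear through
   their universal properties. *)
Section Forcing.

Variables (T : Type) (le : T -> T -> Prop).

Definition is_join (x y z : T) : Prop :=
  [/\ le x z, le y z & forall u, le x u -> le y u -> le z u].

Definition is_meet (x y z : T) : Prop :=
  [/\ le z x, le z y & forall u, le u x -> le u y -> le u z].

Definition congruence (R : T -> T -> Prop) : Prop :=
  [/\ forall x, R x x,
      forall x y, R x y -> R y x,
      forall x y z, R x y -> R y z -> R x z,
      forall x x' y y' z z', R x x' -> R y y' ->
        is_join x y z -> is_join x' y' z' -> R z z'
    & forall x x' y y' z z', R x x' -> R y y' ->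
        is_meet x y z -> is_meet x' y' z' -> R z z'].

Definition strict (x y : T) : Prop := le x y /\ x <> y.

Definition covers (y x : T) : Prop :=
  strict x y /\ ~ exists z, strict x z /\ strict z y.

Definition is_lower_star (j j_ : T) : Prop := unique (covers j) j_.

Definition join_irreducible (j : T) : Prop := exists j_, is_lower_star j j_.

Definition contracted (R : T -> T -> Prop) (j : T) : Prop :=
  exists2 j_, is_lower_star j j_ & R j j_.

(* A relation between join irreducibles only. *)
Definition forces (j j' : T) : Prop :=
  [/\ join_irreducible j, join_irreducible j'
    & forall R, congruence R -> contracted R j -> contracted R j'].

End Forcing.

(** * s-trees *)

(* The labels 1, ..., n are represented by the ordinals 0, ..., n-1. *)
Inductive ptree (n : nat) : Type :=
  | Leaf
  | Node of 'I_n & seq (ptree n).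
Arguments Leaf {n}.

Section Trees.

Variables (n : nat) (s : 'I_n -> nat).

Fixpoint labels (t : ptree n) : seq 'I_n :=
  if t is Node i ts then i :: flatten [seq labels u | u <- ts] else [::].

Definition leaf_or_gt (i : 'I_n) (t : ptree n) : bool :=
  if t is Node k _ then i < k else true.

Fixpoint increasing_arity (t : ptree n) : bool :=
  if t is Node i ts then
    [&& size ts == (s i).+1, all (leaf_or_gt i) ts & all increasing_arity ts]
  else true.

(* The unlabeled root, having a single child, is left implicit: a tree is
   represented by the child of its root. *)
Definition is_stree (t : ptree n) : bool :=
  increasing_arity t && perm_eq (labels t) (enum 'I_n).

Definition stree : Type := {t : ptree n | is_stree t}.

(* The path from the root to node [v], as the sequence of the positions
   (from the left, starting at 0) of the edges it follows. *)
Fixpoint path_to (v : 'I_n) (t : ptree n) : seq nat :=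
  if t is Node k ts then
    if k == v then [::] else
    let m := find (fun u => v \in labels u) ts in
    m :: nth [::] [seq path_to v u | u <- ts] m
  else [::].

(* [right_of e p]: the path [e] leaves the path [p] to its right. *)
Fixpoint right_of (e p : seq nat) : bool :=
  match e, p with
  | x :: e', y :: p' => (y < x) || (x == y) && right_of e' p'
  | _, _ => false
  end.

(* The [c]-th outgoing edge of [i] is identified with the path from the root
   that ends with it. *)
Definition pos (t : ptree n) (i j : 'I_n) : nat :=
  minn (s i)
    (count (fun c => right_of (rcons (path_to i t) c) (path_to j t))
           (iota 0 (s i).+1)).

Definition weak_le (t t' : stree) : Prop :=
  forall i j : 'I_n, i < j -> pos (val t) i j <= pos (val t') i j.

(** * s-arcs *)

Record sarc : Type := SArc {
  arc_i : 'I_n;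
  arc_j : 'I_n;
  arc_A : {set 'I_n};
  arc_B : {set 'I_n};
  arc_r : nat;
  arc_ltij : arc_i < arc_j;
  arc_disj : [disjoint arc_A & arc_B];
  arc_cover : arc_A :|: arc_B = [set k : 'I_n | arc_i < k < arc_j & s k != 0];
  arc_r_range : 1 <= arc_r <= s arc_i
}.

Definition subarc (a a' : sarc) : Prop :=
  [/\ arc_i a' <= arc_i a /\ arc_j a <= arc_j a',
      arc_A a \subset arc_A a' /\ arc_B a \subset arc_B a',
      s (arc_j a) = 0 -> arc_j a = arc_j a',
      arc_i a' = arc_i a -> arc_r a = arc_r a'
    & arc_i a' < arc_i a ->
        (arc_i a \in arc_A a' /\ arc_r a = 1) \/
        (arc_i a \in arc_B a' /\ arc_r a = s (arc_i a))].

Fixpoint comb (l : seq 'I_n) : ptree n :=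
  if l is k :: l' then Node k (rcons (nseq (s k) Leaf) (comb l')) else Leaf.

(* [enum J] lists [J] increasingly. *)
Definition right_comb (J : {set 'I_n}) : ptree n := comb (enum J).

(* Replaces the child of [i] at position [p] (from the left, starting at 0)
   by [u]. *)
Fixpoint graft (i : 'I_n) (p : nat) (u t : ptree n) : ptree n :=
  if t is Node k ts then
    Node k (if k == i then set_nth Leaf ts p u
            else [seq graft i p u v | v <- ts])
  else Leaf.

(* Among [s i + 1] edges, the (r+1)-st from the right has position [s i - r]
   from the left. *)
Definition tree_of_arc (a : sarc) : ptree n :=
  let J := arc_j a |: arc_A a in
  graft (arc_i a) (s (arc_i a) - arc_r a) (right_comb J) (right_comb (~: J)).

Lemma labels_comb l : labels (comb l) = l.
Proof.
elim: l => //= k l IH; congr (_ :: _).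
rewrite map_rcons flatten_rcons IH map_nseq /=.
by elim: (s k).
Qed.

Lemma leaf_or_gt_comb (i : 'I_n) l : all (fun k : 'I_n => i < k) l ->
  leaf_or_gt i (comb l).
Proof. by case: l => //= k l /andP[]. Qed.

Lemma increasing_arity_comb l :
  sorted (fun i j : 'I_n => i < j) l -> increasing_arity (comb l).
Proof.
have tr : transitive (fun i j : 'I_n => i < j) by move=> ? ? ?; apply: ltn_trans.
elim: l => //= k l IH; rewrite path_sortedE // => /andP[kl /IH wl].
by rewrite size_rcons size_nseq eqxx !all_rcons leaf_or_gt_comb // wl
           !all_nseq !orbT.
Qed.

Lemma labels_graft_comb i p u l : uniq l -> i \in l -> p < s i ->
  perm_eq (labels (graft i p u (comb l))) (l ++ labels u).
Proof.
move=> + + ps; elim: l => //= k l IH /andP[kl ul].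
have fl m : flatten (nseq m [::]) = [::] :> seq 'I_n by elim: m.
rewrite inE eq_sym; case: (eqVneq k i) => /= [-> _|_ il].
  rewrite perm_cons; clear IH; elim: (s i) p ps => // m IHm [|p] ps /=.
    rewrite map_rcons flatten_rcons map_nseq fl labels_comb perm_catC.
    by [].
  exact: IHm.
rewrite perm_cons !map_rcons map_nseq flatten_rcons map_nseq /= fl.
exact: IH.
Qed.

Lemma increasing_arity_graft_comb i p u l : p < s i ->
  increasing_arity u -> leaf_or_gt i u ->
  increasing_arity (comb l) -> increasing_arity (graft i p u (comb l)).
Proof.
move=> ps wu gu; elim: l => //= k l IH.
rewrite size_rcons size_nseq eqxx !all_rcons => /and3P[_ /andP[gl _] /andP[wl _]].
case: (eqVneq k i) gl => [-> gl|_ gl].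
  have all_set (P : pred (ptree n)) : P Leaf -> P u -> P (comb l) ->
      all P (set_nth Leaf (rcons (nseq (s i) Leaf) (comb l)) p u).
    move=> Pl Pu Pc; clear IH; elim: (s i) p ps => // m IHm [|q] qs /=.
      by rewrite Pu all_rcons Pc all_nseq Pl orbT.
    by rewrite Pl IHm.
  rewrite !all_set // size_set_nth size_rcons size_nseq.
  by move/maxn_idPr: (ltnW ps : p.+1 <= (s i).+1) => ->; rewrite eqxx.
rewrite size_map size_rcons size_nseq eqxx map_rcons map_nseq /=.
rewrite !all_rcons !all_nseq !orbT IH // !andbT.
by case: (l) gl.
Qed.

Lemma sorted_enum_ord (J : {set 'I_n}) :
  sorted (fun i j : 'I_n => i < j) (enum J).
Proof.
rewrite {1}/enum_mem -enumT; apply: sorted_filter.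
  by move=> ? ? ?; apply: ltn_trans.
have := iota_ltn_sorted 0 n; rewrite -val_enum_ord sorted_map.
by [].
Qed.

Lemma is_stree_tree_of_arc (a : sarc) : is_stree (tree_of_arc a).
Proof.
case: a => i j A B r ij dAB cAB r0s; have /andP[r0 rs] := r0s.
rewrite /is_stree /tree_of_arc /right_comb /=; set J := j |: A.
have ps : s i - r < s i by rewrite ltn_subrL r0 (leq_trans r0).
have Jgt k : k \in J -> i < k.
  rewrite !inE => /orP[/eqP->//|kA].
  have : k \in A :|: B by rewrite inE kA.
  by rewrite cAB inE => /andP[/andP[]].
have iJ : i \in enum (~: J).
  by rewrite mem_enum inE; apply/negP => /Jgt; rewrite ltnn.
apply/andP; split.
  apply: increasing_arity_graft_comb => //.
  - by apply: increasing_arity_comb; apply: sorted_enum_ord.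
  - by apply: leaf_or_gt_comb; apply/allP => k; rewrite mem_enum => /Jgt.
  - by apply: increasing_arity_comb; apply: sorted_enum_ord.
apply: perm_trans (labels_graft_comb _ (enum_uniq _) iJ ps) _.
rewrite labels_comb; apply: uniq_perm; rewrite ?enum_uniq //.
  rewrite cat_uniq !enum_uniq andbT andTb.
  by apply/hasPn => k; rewrite mem_enum /= mem_enum => kJ; rewrite inE negbK.
by move=> k; rewrite mem_cat !mem_enum inE orNb.
Qed.

Definition stree_of_arc (a : sarc) : stree :=
  exist _ (tree_of_arc a) (is_stree_tree_of_arc a).

End Trees.

(* Main.v *)
Require Import Defs.
From mathcomp Require Import all_boot.
From mathcomp Require Import zify.
Set Implicit Arguments.
Unset Strict Implicit.
Unset Printing Implicit Defensive.

(* Trees are encoded by their functions [pos], which are exactly the functions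
   satisfying transitivity and planarity ([is_pos]). The join is then the
   transitive closure of the pointwise maximum, and meets follow by the duality
   [f |-> s - f].

   If [a] is not a subarc of [a'], relate two trees that are above the same trees
   of arcs not containing [a]. This contracts [a] and not [a'], and it is a
   congruence because whether the tree of an arc [b] is below a join [x \/ y] is
   determined by the trees of subarcs of [b] below [x] or below [y]
   ([arc_le_join]).

   If [a] is a subarc of [b], there is a tree [x] such that the tree of [b] is
   below the join of [x] with the tree of [a], but not below the join of [x] with
   its lower cover. If [a] is contracted, then meeting both joins with the tree
   of [b] contracts [b]. *)

(** * Labels of subtrees and recursive formulas for [pos] *)

Section Trees.

Variables (n : nat) (s : 'I_n -> nat).
Implicit Types (t u : ptree n) (ts : seq (ptree n)) (i j k v : 'I_n) (l : seq 'I_n).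

(** Children are addressed by position, with [Leaf] as default out of range, so that induction
    hypotheses carry no membership condition. *)
Lemma ptree_nth_ind (P : ptree n -> Prop) :
  P Leaf ->
  (forall k ts, (forall m, P (nth Leaf ts m)) -> P (Node k ts)) ->
  forall t, P t.
Proof.
move=> PL PN; fix IH 1 => -[//|k ts]; apply: PN.
elim: ts => [|u ts IHts] [|m] /=; [exact: PL|exact: PL|exact: IH|exact: IHts].
Qed.

Definition flabels ts : seq 'I_n := flatten [seq labels u | u <- ts].

Definition child v ts : nat := find (fun u => v \in labels u) ts.

Lemma child_lt v ts : v \in flabels ts -> child v ts < size ts.
Proof.
rewrite -has_find; elim: ts => //= u ts IH.
by rewrite /flabels /= mem_cat => /orP[->//|/IH->]; rewrite orbT.
Qed.

Lemma mem_child v ts : v \in flabels ts -> v \in labels (nth Leaf ts (child v ts)).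
Proof. by move=> /child_lt; rewrite -has_find => /(nth_find Leaf). Qed.

Lemma mem_flabels v ts m : v \in labels (nth Leaf ts m) -> v \in flabels ts.
Proof.
elim: ts m => [|u ts IH] [|m] //=; rewrite /flabels /= mem_cat; first by move->.
by move=> /IH vts; apply/orP; right.
Qed.

Lemma uniq_nth_labels ts m : uniq (flabels ts) -> uniq (labels (nth Leaf ts m)).
Proof.
elim: ts m => [|u ts IH] [|m] //=; rewrite /flabels /= cat_uniq => /and3P[] //.
by move=> _ _ /IH.
Qed.

Lemma child_uniq v ts m :
  uniq (flabels ts) -> v \in labels (nth Leaf ts m) -> child v ts = m.
Proof.
rewrite /child; elim: ts m => [|u ts IH] [|m] //=; rewrite /flabels /= cat_uniq.
  by move=> _ ->.
move=> /and3P[_ /hasPn disj uts] vm.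
have := disj _ (mem_flabels vm); rewrite /= => /negPf ->.
by rewrite (IH m).
Qed.

Lemma flabels_gt k t : leaf_or_gt k t -> increasing_arity s t ->
  {in labels t, forall v, k < v}.
Proof.
elim/ptree_nth_ind: t k => [|i ts IH] k //= ki /and3P[sz gts its] v.
rewrite inE => /orP[/eqP->//|vts]; apply: ltn_trans ki _.
have lt_c := child_lt vts; move: (mem_child vts).
by apply: IH; [apply: (all_nthP Leaf gts)|apply: (all_nthP Leaf its)].
Qed.

Lemma increasing_arity_Node k ts : increasing_arity s (Node k ts) =
  [&& size ts == (s k).+1, all (leaf_or_gt k) ts & all (increasing_arity s) ts].
Proof. by []. Qed.

(** Unlike [is_stree], this condition passes to children, whose labels are only part of ['I_n]. *)
Definition wf_tree t := increasing_arity s t && uniq (labels t).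

Lemma wf_size k ts : wf_tree (Node k ts) -> size ts = (s k).+1.
Proof. by case/andP => /= /and3P[/eqP]. Qed.

Lemma wf_uniq k ts : wf_tree (Node k ts) -> uniq (flabels ts).
Proof. by case/andP => /= _ /andP[]. Qed.

Lemma wf_nth k ts m : wf_tree (Node k ts) -> wf_tree (nth Leaf ts m).
Proof.
case/andP => /= /and3P[_ _ its] /andP[_ uts].
rewrite /wf_tree uniq_nth_labels // andbT.
case: (ltnP m (size ts)) => [lt_m|/(nth_default _)->//].
exact: (all_nthP Leaf its).
Qed.

Lemma wf_gt k ts v : wf_tree (Node k ts) -> v \in flabels ts -> k < v.
Proof.
case/andP => /= /and3P[_ gts its] _ vts; have lt_c := child_lt vts.
by apply: flabels_gt (mem_child vts);
  [apply: (all_nthP Leaf gts)|apply: (all_nthP Leaf its)].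
Qed.

Lemma path_to_child v k ts : v \in flabels ts -> k != v ->
  path_to v (Node k ts) = child v ts :: path_to v (nth Leaf ts (child v ts)).
Proof.
by move=> vts /negPf /= ->; rewrite -/(child v ts) (nth_map Leaf) ?child_lt.
Qed.

Lemma pos_le t i j : pos s t i j <= s i.
Proof. exact: geq_minl. Qed.

Lemma count_ltn_iota m N : m <= N -> count (ltn m) (iota 0 N.+1) = N - m.
Proof.
move=> le_m; rewrite -[N.+1](subnKC (leqW le_m)) iotaD count_cat add0n.
rewrite (@eq_in_count _ _ pred0) ?count_pred0; last first.
  by move=> c; rewrite mem_iota /=; lia.
rewrite subSn //= ltnn !add0n (@eq_in_count _ _ predT) ?count_predT ?size_iota //.
by move=> c; rewrite mem_iota /=; lia.
Qed.

Lemma pos_root i ts j : wf_tree (Node i ts) -> j \in flabels ts ->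
  pos s (Node i ts) i j = s i - child j ts.
Proof.
move=> wf jts; have ij := wf_gt wf jts; have := child_lt jts.
rewrite (wf_size wf) /pos ltnS (path_to_child jts) -?val_eqE ?ltn_eqF //.
have -> : path_to i (Node i ts) = [::] by rewrite /= eqxx.
move: (child j ts) => m le_m; rewrite (eq_count (a2 := ltn m)).
  by rewrite count_ltn_iota //; apply/minn_idPr/leq_subr.
by move=> c /=; rewrite andbF orbF.
Qed.

(** When [i] and [j] lie under different children, either all [s i + 1] edges of [i] are to the
    right of the path to [j], or none is; the minimum in [pos] caps the first count at [s i]. *)
Lemma pos_below k ts i j : wf_tree (Node k ts) ->
  i \in flabels ts -> j \in flabels ts ->
  pos s (Node k ts) i j =
  if child j ts < child i ts then s i else
  if child i ts < child j ts then 0 else pos s (nth Leaf ts (child i ts)) i j.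
Proof.
move=> wf its jts.
have neq v : v \in flabels ts -> k != v.
  by move=> /(wf_gt wf) kv; rewrite -val_eqE ltn_eqF.
rewrite /pos !path_to_child ?neq //=; case: ltngtP => /= [lt_ji|lt_ij|<-//].
  by rewrite count_predT size_iota; apply/minn_idPl.
by rewrite count_pred0 minn0.
Qed.

(* The last two conditions are transitivity and planarity. *)
Definition is_pos (f : 'I_n -> 'I_n -> nat) : Prop :=
  [/\ forall i j, f i j <= s i,
      forall i j k, i < j -> j < k -> 0 < f j k -> f i j <= f i k
    & forall i j k, i < j -> j < k -> f j k < s j -> f i k <= f i j].

(** Labels increase downwards, so only [i] can be the root, and then both values are read off child
    indices. Otherwise labels under distinct children give extreme values, and three labels under
    one child are handled by induction. *)
Lemma pos_trans_planar t i j k : wf_tree t ->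
  i \in labels t -> j \in labels t -> k \in labels t -> i < j -> j < k ->
  (0 < pos s t j k -> pos s t i j <= pos s t i k) /\
  (pos s t j k < s j -> pos s t i k <= pos s t i j).
Proof.
elim/ptree_nth_ind: t => // r ts IH wf.
rewrite !inE -!/(flabels ts) => ri rj rk ij jk.
have root_le v : (v == r) || (v \in flabels ts) -> r <= v.
  by case/orP=> [/eqP->|/(wf_gt wf)/ltnW].
have le_ri := root_le _ ri.
have below v : (v == r) || (v \in flabels ts) -> r < v -> v \in flabels ts.
  by case/orP=> // /eqP->; rewrite ltnn.
have {rj}jts := below _ rj (leq_ltn_trans le_ri ij).
have {rk}kts := below _ rk (ltn_trans (leq_ltn_trans le_ri ij) jk).
rewrite (pos_below wf jts kts); case/orP: ri => [/eqP->|its].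
  rewrite !(pos_root wf) //.
  by case: (ltngtP (child k ts) (child j ts)) => cjk; lia.
have := pos_le (nth Leaf ts (child i ts)) i j.
have := pos_le (nth Leaf ts (child i ts)) i k.
rewrite !(pos_below wf) //.
have := IH (child i ts) (wf_nth _ wf) (mem_child its).
case: (ltngtP (child j ts) (child i ts)) => cij;
  case: (ltngtP (child k ts) (child i ts)) => cik;
  case: (ltngtP (child k ts) (child j ts)) => cjk; try (clear -cij cik cjk; lia);
  try (clear; lia).
rewrite -{1 2}cij (mem_child jts) {1}cij -cik (mem_child kts) cik.
by move=> + _ _; rewrite cij; apply.
Qed.

Lemma stree_wf (t : stree s) : wf_tree (val t).
Proof.
case: t => t /= /andP[it lt]; rewrite /wf_tree it.
by rewrite (perm_uniq lt) enum_uniq.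
Qed.

Lemma stree_mem (t : stree s) v : v \in labels (val t).
Proof.
by case: t => t /= /andP[_ lt]; rewrite (perm_mem lt) mem_enum.
Qed.

Lemma is_pos_tree (t : stree s) : is_pos (pos s (val t)).
Proof.
by split=> [i j|i j k ij jk|i j k ij jk]; first exact: pos_le;
  case: (pos_trans_planar (stree_wf t) (stree_mem t i) (stree_mem t j)
           (stree_mem t k) ij jk).
Qed.

(** * Reconstruction of a tree from its function [pos] *)

Definition edges i : seq nat := iota 0 (s i).+1.

(* [m] bounds the size of [l], which lists increasingly the labels of the tree. *)
Fixpoint build (m : nat) (f : 'I_n -> 'I_n -> nat) l : ptree n :=
  if m isn't m'.+1 then Leaf else
  if l isn't i :: l' then Leaf else
  Node i [seq build m' f [seq k <- l' | s i - f i k == c] | c <- edges i].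

Lemma labels_buildS m f i l : labels (build m.+1 f (i :: l)) =
  i :: flatten [seq labels (build m f [seq k <- l | s i - f i k == c]) | c <- edges i].
Proof. by rewrite [in RHS](map_comp (@labels n)). Qed.

Local Notation ltI := (fun i j : 'I_n => i < j).

Lemma sorted_ltI_cons i l : sorted ltI (i :: l) = all (ltI i) l && sorted ltI l.
Proof. by rewrite /= path_sortedE // => ? ? ?; apply: ltn_trans. Qed.

Lemma sorted_ltI_uniq l : sorted ltI l -> uniq l.
Proof.
by apply: sorted_uniq => [? ? ?|?]; [apply: ltn_trans|rewrite ltnn].
Qed.

Lemma sorted_ltI_filter a l : sorted ltI l -> sorted ltI (filter a l).
Proof. by apply: sorted_filter => ? ? ?; apply: ltn_trans. Qed.

Lemma perm_flatten_filter (T : eqType) (g : 'I_n -> T) (cs : seq T) l :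
  uniq cs ->
  perm_eq (flatten [seq [seq k <- l | g k == c] | c <- cs])
          [seq k <- l | g k \in cs].
Proof.
elim: cs => [|c cs IH] /=.
  by move=> _; rewrite (eq_filter (a2 := pred0)) ?filter_pred0.
move=> /andP[ccs /IH{}IH].
rewrite perm_sym -(perm_filterC (fun k => g k == c)) perm_sym -!filter_predI.
apply: perm_cat.
  rewrite (eq_filter (a2 := predI (fun k => g k == c) (fun k => g k \in c :: cs))) //.
  by move=> k /=; case: eqVneq => //= ->; rewrite mem_head.
rewrite (eq_filter (a1 := predI _ _) (a2 := fun k => g k \in cs)) // => k /=.
by rewrite inE; case: eqVneq => //= ->; rewrite (negPf ccs).
Qed.

Lemma labels_build m f l : size l <= m -> perm_eq (labels (build m f l)) l.
Proof.
elim: m l => [|m IH] [|i l] // lm; rewrite labels_buildS perm_cons.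
apply: (@perm_trans _ (flatten
   [seq [seq k <- l | s i - f i k == c] | c <- edges i])).
  elim: (edges i) => //= c cs IHcs; apply: perm_cat => //.
  apply: IH; rewrite size_filter; apply: leq_trans (count_size _ _) _.
  by [].
rewrite (permPl (perm_flatten_filter _ _ _)) ?iota_uniq //.
rewrite (eq_filter (a2 := predT)) ?filter_predT // => k.
by rewrite /edges mem_iota /= add0n ltnS leq_subr.
Qed.

Lemma increasing_build m f l : sorted ltI l -> increasing_arity s (build m f l).
Proof.
elim: m l => [|m IH] [|i l] // sl.
move: sl; rewrite sorted_ltI_cons => /andP[/allP il sl].
rewrite increasing_arity_Node size_map /edges size_iota eqxx !all_map andTb.
apply/andP; split; apply/allP=> c _.
  case: m {IH} => //= m.
  case E: [seq _ <- _ | _] => [//|k l'] /=; apply: il.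
  have: k \in [seq k <- l | s i - f i k == c] by rewrite E mem_head.
  by rewrite mem_filter => /andP[].
exact/IH/sorted_ltI_filter.
Qed.

Lemma wf_build m f l : sorted ltI l -> size l <= m -> wf_tree (build m f l).
Proof.
move=> sl lm; rewrite /wf_tree increasing_build //.
by rewrite (perm_uniq (labels_build f lm)) sorted_ltI_uniq.
Qed.

(** The child chosen for each label matches [pos_root]. When [i] and [j] are sent to different
    children of [r], planarity of the triple [r], [i], [j] forces [f i j = s i] and transitivity
    forces [f i j = 0], exactly as in [pos_below]. *)
Lemma pos_build m f l i j : is_pos f -> sorted ltI l -> size l <= m ->
  i \in l -> j \in l -> i < j -> pos s (build m f l) i j = f i j.
Proof.
move=> [fs fT fP]; elim: m l => [|m IH] [|r l] // sl lm.
have wf := wf_build f sl lm; have pl := labels_build f lm.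
move: sl pl wf; rewrite sorted_ltI_cons => /andP[/allP rl sl].
have -> : build m.+1 f (r :: l) = Node r
  [seq build m f [seq k <- l | s r - f r k == c] | c <- edges r] by [].
set ts := [seq _ | _ <- _]; rewrite perm_cons => pl wf.
rewrite !inE => ri rj ij.
have {pl}fl v : (v \in flabels ts) = (v \in l) by rewrite -(perm_mem pl).
have nth_ts c : c < (s r).+1 ->
    nth Leaf ts c = build m f [seq k <- l | s r - f r k == c].
  by move=> cs; rewrite (nth_map 0) /edges ?size_iota // nth_iota.
have szm c : size [seq k <- l | s r - f r k == c] <= m.
  by rewrite size_filter; apply: leq_trans (count_size _ _) _.
have ch v : v \in l -> child v ts = s r - f r v.
  move=> vl; apply: child_uniq; first exact: wf_uniq wf.
  rewrite nth_ts; last by lia.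
  by rewrite (perm_mem (labels_build _ _)) // mem_filter eqxx.
have le_ri : r <= i by case/orP: ri => [/eqP->|/rl/ltnW].
have {rj}jl : j \in l.
  by case/orP: rj => // /eqP jr; move: ij; rewrite jr; lia.
case/orP: ri => [/eqP ir|il].
  by rewrite ir pos_root ?fl // ch //; have := fs r j; lia.
have [lri lrj] := (rl _ il, rl _ jl); simpl in lri.
rewrite pos_below ?fl // !ch //.
have [fi fj fij] := And3 (fs r i) (fs r j) (fs i j).
have T := fT _ _ _ lri ij; have P := fP _ _ _ lri ij.
case: ltnP => c1; first by lia.
case: ltnP => c2; first by lia.
rewrite nth_ts; last by lia.
by apply: IH => //; rewrite ?sorted_ltI_filter // mem_filter ?il ?jl andbT; lia.
Qed.

(** The least label must be the root, and its row gives the child of every other label. Agreement of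
    [f] with [pos] is asked only on the labels of [t], so that it is inherited by each child with
    the same [f]. *)
Lemma build_pos m f l t : wf_tree t -> sorted ltI l -> size l <= m ->
  perm_eq l (labels t) ->
  {in labels t &, forall i j, i < j -> f i j = pos s t i j} -> build m f l = t.
Proof.
elim/ptree_nth_ind: t m l => [|k ts IH] m l wf sl lm pl fpos.
  by case: l pl {sl lm} => [_|? ? /perm_size//]; case: m.
case: l sl lm pl => [|k' l] sl lm pl; first by move/perm_size: pl.
case: m lm => // m lm.
move: sl; rewrite sorted_ltI_cons => /andP[/allP kl sl].
have kk : k' = k.
  have : k' \in labels (Node k ts) by rewrite -(perm_mem pl) mem_head.
  have : k \in k' :: l by rewrite (perm_mem pl) mem_head.
  rewrite !inE; case/predU1P => [->//|/kl k'k] /predU1P[//|/(wf_gt wf)].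
  by move: k'k => /=; lia.
move: kk lm pl kl => -> lm; rewrite perm_cons -/(flabels ts) => pl kl.
have -> : build m.+1 f (k :: l) = Node k
  [seq build m f [seq v <- l | s k - f k v == c] | c <- edges k] by [].
have fch v : v \in l -> s k - f k v = child v ts.
  rewrite (perm_mem pl) => vts.
  rewrite fpos ?inE ?eqxx ?vts ?orbT ?(wf_gt wf) //.
  by rewrite pos_root //; have := child_lt vts; rewrite (wf_size wf); lia.
congr Node; apply: (@eq_from_nth _ Leaf); rewrite size_map /edges size_iota ?(wf_size wf) //.
move=> c cs; rewrite (nth_map 0) /edges ?size_iota // nth_iota // add0n.
have chl v : (v \in labels (nth Leaf ts c)) = (v \in l) && (s k - f k v == c).
  apply/idP/andP => [vc|[vl /eqP]].
    have vl : v \in l by rewrite (perm_mem pl) (mem_flabels vc).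
    by rewrite fch // (child_uniq (wf_uniq wf) vc).
  by rewrite fch // => <-; apply: mem_child; rewrite -(perm_mem pl).
apply: IH.
- exact: wf_nth wf.
- exact: sorted_ltI_filter.
- by rewrite size_filter; apply: leq_trans (count_size _ _) _.
- apply: uniq_perm; rewrite ?filter_uniq ?(sorted_ltI_uniq sl) //.
    exact: uniq_nth_labels (wf_uniq wf).
  by move=> v; rewrite mem_filter chl andbC.
- move=> i j ic jc ij; have [im jm] := (mem_flabels ic, mem_flabels jc).
  rewrite fpos ?inE -?/(flabels ts) ?im ?jm ?orbT // pos_below //.
  by rewrite !(child_uniq (wf_uniq wf) (m := c)) // ltnn.
Qed.

Lemma sorted_enum : sorted ltI (enum 'I_n).
Proof.
have := sorted_enum_ord [set: 'I_n].
by rewrite (eq_enum (B := 'I_n)) // => k; rewrite !inE.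
Qed.

Lemma pos_inj (t t' : stree s) :
  (forall i j, i < j -> pos s (val t) i j = pos s (val t') i j) -> t = t'.
Proof.
move=> eq_pos; apply: val_inj.
have perm_enum (u : stree s) : perm_eq (enum 'I_n) (labels (val u)).
  by case: u => u /= /andP[_]; rewrite perm_sym.
have buildE (u : stree s) : (forall i j, i < j -> pos s (val t) i j = pos s (val u) i j) ->
    build (size (enum 'I_n)) (pos s (val t)) (enum 'I_n) = val u.
  move=> eq_u; apply: build_pos => //; first exact: stree_wf.
    exact: sorted_enum.
  by move=> i j _ _ /eq_u.
by rewrite -(buildE t) // (buildE t').
Qed.

Lemma pos_surj f : is_pos f ->
  exists t : stree s, forall i j, i < j -> pos s (val t) i j = f i j.
Proof.
move=> pf; set l := enum 'I_n; pose t := build (size l) f l.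
have ht : is_stree s t.
  by rewrite /is_stree increasing_build ?sorted_enum // labels_build.
exists (exist _ t ht) => i j ij /=.
by apply: pos_build; rewrite ?mem_enum ?sorted_enum.
Qed.

Lemma weak_le_anti (t t' : stree s) : weak_le t t' -> weak_le t' t -> t = t'.
Proof.
move=> tt' t't; apply: pos_inj => i j ij.
by apply/eqP; rewrite eqn_leq tt' ?t't.
Qed.

End Trees.

(** * Joins and meets in the s-weak order *)

Section Lattice.

Variables (n : nat) (s : 'I_n -> nat).
Implicit Types (i j k d e : 'I_n) (f g h : 'I_n -> 'I_n -> nat).

Definition pos_max f g i j : nat := maxn (f i j) (g i j).

Definition step f : rel 'I_n := fun j k => (j < k) && (0 < f j k).

(** Transitive closure of a multi-inversion set: the multiplicity of [(i, j)] spreads to every [k]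
    reachable from [j] along inversions. *)
Definition tclosure f i k : nat :=
  \max_(j : 'I_n | (i < j) && connect (step f) j k) f i j.

Lemma tclosure_ge f i j : i < j -> f i j <= tclosure f i j.
Proof. by move=> ij; apply: leq_bigmax_cond; rewrite ij connect0. Qed.

Lemma tclosure_gt0 f j k : 0 < tclosure f j k -> connect (step f) j k.
Proof.
move=> c_gt0; apply: contraLR (c_gt0) => not_jk; rewrite -eqn0Ngt -leqn0.
apply/bigmax_leqP => d /andP[jd dk]; rewrite leqNgt; apply: contra not_jk => fjd.
by apply: connect_trans dk; apply: connect1; rewrite /step jd.
Qed.

(** Transitivity holds by concatenating chains; the point is that planarity of [f] survives the
    closure. *)
Lemma is_pos_tclosure f :
  (forall i j, f i j <= s i) ->
  (forall i j k, i < j -> j < k -> f j k < s j -> f i k <= f i j) ->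
  is_pos s (tclosure f).
Proof.
move=> fs fP; split=> [i k|i j k ij jk /tclosure_gt0 cjk|i j k ij jk lt_c].
- exact/bigmax_leqP.
- apply/bigmax_leqP => d /andP[id_ dj]; apply: leq_bigmax_cond.
  by rewrite id_ (connect_trans dj).
have below d : j < d -> connect (step f) d k -> f j d < s j.
  move=> jd dk; apply: leq_ltn_trans lt_c; apply: leq_bigmax_cond.
  by rewrite jd.
(* A chain to [k] that jumps over [j] can be stopped at [j]: at the jump from [d] to [e], [below]
   gives [f j e < s j], so planarity gives [f d e <= f d j]. *)
have cross d : connect (step f) d k -> d < j -> connect (step f) d j.
  case/connectP=> p; elim: p d => [|e p IH] d /=; first by move=> _ <-; lia.
  move=> /andP[/andP[de fde] pe] kE dj.
  have ek : connect (step f) e k by apply/connectP; exists p.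
  case: (ltngtP e j) => [ej|je|/val_inj <-].
  - by apply: connect_trans (IH e pe kE ej); apply: connect1; rewrite /step de.
  - apply: connect1; rewrite /step dj (leq_trans fde) //.
    exact: fP (below _ je ek).
  - by apply: connect1; rewrite /step de.
apply/bigmax_leqP => d /andP[id_ dk].
case: (ltngtP d j) => [dj|jd|/val_inj <-]; last exact: tclosure_ge.
  by apply: leq_bigmax_cond; rewrite id_ cross.
by apply: leq_trans (tclosure_ge _ ij); apply: fP (below _ jd dk).
Qed.

(** Transitivity of [h] along a chain from [d] to [k] makes [h d k] positive; one further
    application carries the value at [(i, d)] over to [(i, k)]. *)
Lemma tclosure_le f h : is_pos s h -> (forall i j, i < j -> f i j <= h i j) ->
  forall i j, tclosure f i j <= h i j.
Proof.
move=> [_ hT _] fh i k; apply/bigmax_leqP => d /andP[id_ dk].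
apply: leq_trans (fh _ _ id_) _.
have : d = k \/ d < k /\ 0 < h d k.
  case/connectP: dk => p; elim: p d {id_} => [|e p IH] d /=; first by left.
  move=> /andP[/andP[de fde] pe] kE; right.
  have hde := leq_trans fde (fh _ _ de).
  case: (IH e pe kE) => [<-//|[ek hek]]; split; first exact: ltn_trans ek.
  exact: leq_trans hde (hT _ _ _ de ek hek).
by case=> [->//|[lt_dk h_dk]]; apply: hT.
Qed.

(** Complementation exchanges transitivity and planarity. *)
Lemma is_pos_opp f : is_pos s f -> is_pos s (fun i j => s i - f i j).
Proof.
move=> [fs fT fP]; split=> [i j|i j k ij jk|i j k ij jk]; first exact: leq_subr.
  by rewrite subn_gt0 => /(fP _ _ _ ij jk); lia.
by move=> lt_s; have := fT _ _ _ ij jk; lia.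
Qed.

Implicit Types x y z u t : stree s.
Local Notation "x .p" := (pos s (val x)) (at level 1, format "x .p").

Lemma join_exists x y : exists2 z, is_join (@weak_le n s) x y z &
  forall i j, i < j -> z.p i j = tclosure (pos_max x.p y.p) i j.
Proof.
have [xs xT xP] := is_pos_tree x; have [ys yT yP] := is_pos_tree y.
set f := pos_max _ _.
have pf : is_pos s (tclosure f).
  (* A pointwise maximum inherits planarity, though in general not transitivity, which the closure
     restores. *)
  apply: is_pos_tclosure => [i j|i j k ij jk]; first by rewrite geq_max xs ys.
  rewrite gtn_max => /andP[/(xP _ _ _ ij jk) fx /(yP _ _ _ ij jk) fy].
  by rewrite geq_max !leq_max fx fy orbT.
have [z zE] := pos_surj pf; exists z => //; split=> [i j ij|i j ij|u xu yu i j ij];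
  rewrite zE //.
- by apply: leq_trans (tclosure_ge _ ij); apply: leq_maxl.
- by apply: leq_trans (tclosure_ge _ ij); apply: leq_maxr.
- apply: (tclosure_le (is_pos_tree u)) => i' j' ij'.
  by rewrite geq_max xu ?yu.
Qed.

Lemma join_pos x y z : is_join (@weak_le n s) x y z ->
  forall i j, i < j -> z.p i j = tclosure (pos_max x.p y.p) i j.
Proof.
move=> [xz yz z_min]; have [z' [xz' yz' z'_min] z'E] := join_exists x y.
by rewrite (_ : z = z') //; apply: weak_le_anti; [apply: z_min|apply: z'_min].
Qed.

Lemma mirror x : exists x', forall i j, i < j -> x'.p i j = s i - x.p i j.
Proof. exact: pos_surj (is_pos_opp (is_pos_tree x)). Qed.

(** The meet is the mirror image of the join of the mirror images. *)
Lemma meet_exists x y : exists z, is_meet (@weak_le n s) x y z.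
Proof.
have [[x' x'E] [y' y'E]] := (mirror x, mirror y).
have [z' [xz' yz' z'_min] _] := join_exists x' y'.
have [z zE] := mirror z'; have bd (t : stree s) i j : t.p i j <= s i by apply: pos_le.
exists z; split=> [i j ij|i j ij|u ux uy i j ij]; rewrite zE //.
- by have := xz' _ _ ij; rewrite x'E //; have := bd x i j; lia.
- by have := yz' _ _ ij; rewrite y'E //; have := bd y i j; lia.
- have [u' u'E] := mirror u; have /(_ i j ij) : weak_le z' u'.
    apply: z'_min => i' j' ij'; rewrite u'E // ?x'E ?y'E //.
      by have := ux _ _ ij'; lia.
    by have := uy _ _ ij'; lia.
  by rewrite u'E //; have := bd u i j; lia.
Qed.

(** Criterion for functions whose nonzero values depend only on the row; it serves both the trees of
    arcs and the separators. Planarity asks something at [j] only when [f j k < s j], which excludes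
    [s j = 0]. *)
Lemma is_pos_rel (E : rel 'I_n) (v : 'I_n -> nat) :
  (forall i, v i <= s i) ->
  (forall i j k, E i j -> E j k -> E i k) ->
  (forall i j k, i < j -> j < k -> s j != 0 -> E i k ->
     E i j || E j k && (v j == s j)) ->
  is_pos s (fun i j => if E i j then v i else 0).
Proof.
move=> vs Etr Epl; split=> [i j|i j k ij jk|i j k ij jk].
- by case: ifP.
- by case: ifP => // jk_E _; case: ifP => // /Etr ->.
- move=> lt_s; case: ifP => // ik; have sj : s j != 0 by lia.
  have := Epl _ _ _ ij jk sj ik; case: ifP => //= _.
  by case: ifP lt_s => //= _ lt_s /eqP vj; lia.
Qed.

End Lattice.

(** * The function [pos] of the tree of an arc *)

Section ArcTrees.

Variables (n : nat) (s : 'I_n -> nat).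
Implicit Types (i j k c d : 'I_n) (l J : seq 'I_n) (t u : ptree n) (a : sarc s).

Local Notation ltI := (fun i j : 'I_n => i < j).

Lemma flabels_rcons_leaf m t : flabels (rcons (nseq m Leaf) t) = labels t.
Proof. by rewrite /flabels; elim: m => //=; rewrite cats0. Qed.

Lemma nth_rcons_leaf m t : nth Leaf (rcons (nseq m Leaf) t) m = t.
Proof. by rewrite nth_rcons size_nseq ltnn eqxx. Qed.

Lemma child_rcons_leaf m t v :
  v \in labels t -> child v (rcons (nseq m Leaf) t) = m.
Proof. by move=> vt; rewrite /child; elim: m => /= [|m ->] //; rewrite vt. Qed.

Lemma pos_rcons_leaf i j k t : let r := Node k (rcons (nseq (s k) Leaf) t) in
  wf_tree s r -> i \in labels r -> j \in labels r -> i < j ->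
  pos s r i j = if i == k then 0 else pos s t i j.
Proof.
move=> r wf; rewrite /r /= -/(flabels _) flabels_rcons_leaf !inE => ri rj ij.
have gt v : v \in labels t -> k < v.
  by rewrite -(flabels_rcons_leaf (s k)) => /(wf_gt wf).
have jt : j \in labels t.
  case/predU1P: rj ij => // -> ; case/predU1P: ri => [->|/gt]; lia.
have jts : j \in flabels (rcons (nseq (s k) Leaf) t) by rewrite flabels_rcons_leaf.
case/predU1P: ri => [->|it].
  by rewrite eqxx pos_root // child_rcons_leaf // subnn.
have its : i \in flabels (rcons (nseq (s k) Leaf) t) by rewrite flabels_rcons_leaf.
rewrite pos_below // !child_rcons_leaf // ltnn nth_rcons_leaf.
by have := gt _ it; rewrite -val_eqE; case: eqP => //=; lia.
Qed.

Lemma wf_comb l : sorted ltI l -> wf_tree s (comb s l).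
Proof.
by move=> sl; rewrite /wf_tree increasing_arity_comb // labels_comb sorted_ltI_uniq.
Qed.

Lemma pos_comb l i j : sorted ltI l -> i \in l -> j \in l -> i < j ->
  pos s (comb s l) i j = 0.
Proof.
elim: l => // k l IH sl il jl ij.
rewrite /= pos_rcons_leaf -/(comb s (k :: l)) ?labels_comb //; last exact: wf_comb.
move: sl il jl; rewrite sorted_ltI_cons !inE => /andP[/allP kl sl].
case: eqVneq => //= ik il /predU1P[jk|jl]; last exact: IH.
by have := kl _ il; move: ij; rewrite jk /=; lia.
Qed.

(** Below [i], the comb on [J] hangs to the left of the rest of [l]. Hence a path into [J] leaves
    [s i - p] edges of [i], and all edges of each later label of [l], to its right. Every other pair
    has value 0, because the path to [d] follows rightmost edges past [c] or passes to the right of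
    [c]. *)
Lemma pos_graft_comb i p l J c d : sorted ltI l -> sorted ltI J -> uniq (l ++ J) ->
  i \in l -> p < s i -> all (ltI i) J -> c \in l ++ J -> d \in l ++ J -> c < d ->
  pos s (graft i p (comb s J) (comb s l)) c d =
  if [&& c \notin J, d \in J & i <= c] then
    if c == i then s i - p else s c
  else 0.
Proof.
move=> + sJ + + ps iJ; elim: l => // k l IH sl ul il cl dl cd.
have wf : wf_tree s (graft i p (comb s J) (comb s (k :: l))).
  apply/andP; split.
    by rewrite increasing_arity_graft_comb ?increasing_arity_comb ?leaf_or_gt_comb.
  have ukl : uniq (k :: l) by move: ul; rewrite cat_uniq => /andP[].
  by rewrite (perm_uniq (labels_graft_comb _ ukl il ps)) labels_comb.
move: (sl); rewrite sorted_ltI_cons => /andP[/allP kl {}sl].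
have {}ul : uniq (l ++ J) by move: ul => /= /andP[].
have JNl v : v \in l -> v \notin J.
  move=> vl; apply/negP => vJ; move: ul; rewrite cat_uniq => /and3P[_ /hasPn].
  by move=> /(_ _ vJ) /=; rewrite vl.
case: (eqVneq k i) => [ki|ki]; last first.
  have {}il : i \in l by move: il; rewrite inE eq_sym (negPf ki).
  have ki_lt : k < i by apply: kl.
  have kJ : k \notin J by apply/negP => /(allP iJ) /=; rewrite ltnNge ltnW.
  have tE : graft i p (comb s J) (comb s (k :: l)) =
      Node k (rcons (nseq (s k) Leaf) (graft i p (comb s J) (comb s l))).
    by rewrite /= (negPf ki) map_rcons map_nseq.
  have ml v : (v \in labels (graft i p (comb s J) (comb s l))) = (v \in l ++ J).
    by rewrite (perm_mem (labels_graft_comb _ (sorted_ltI_uniq sl) il ps)) mem_cat labels_comb -mem_cat.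
  rewrite tE in wf *; move: cl dl; rewrite /= !inE => cl dl.
  rewrite pos_rcons_leaf //=; first last.
  - by rewrite inE -/(flabels _) flabels_rcons_leaf ml.
  - by rewrite inE -/(flabels _) flabels_rcons_leaf ml.
  case: eqVneq cl => [->|ck] /= cl; first by rewrite leqNgt ki_lt !andbF.
  have dlJ : d \in l ++ J.
    case/predU1P: dl => // dk; move: cd; rewrite dk ltnNge ltnW //; move: cl.
    by rewrite mem_cat => /orP[/kl|/(allP iJ)] //; apply: ltn_trans.
  exact: IH.
move: ki wf kl cl dl => -> wf kl cl dl {il IH}; move: wf.
rewrite /= eqxx; set ts := set_nth _ _ _ _ => wf.
have nJ : nth Leaf ts p = comb s J by rewrite nth_set_nth /= eqxx.
have nl : nth Leaf ts (s i) = comb s l.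
  by rewrite nth_set_nth /= gtn_eqF // nth_rcons_leaf.
have us := wf_uniq wf.
have inJ v : v \in J -> v \in flabels ts /\ child v ts = p.
  move=> vJ; have vp : v \in labels (nth Leaf ts p) by rewrite nJ labels_comb.
  by rewrite (mem_flabels vp) (child_uniq us vp).
have inl v : v \in l -> v \in flabels ts /\ child v ts = s i.
  move=> vl; have vp : v \in labels (nth Leaf ts (s i)) by rewrite nl labels_comb.
  by rewrite (mem_flabels vp) (child_uniq us vp).
have gti v : v \in l ++ J -> i < v.
  by rewrite mem_cat => /orP[/kl|/(allP iJ)].
have {}dl : d \in l ++ J.
  case/predU1P: dl => // di; move: cd; rewrite di ltnNge.
  by case/predU1P: cl => [->|/gti/ltnW->//]; rewrite leqnn.
have iJn : i \notin J by apply/negP => /(allP iJ) /=; rewrite ltnn.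
case/predU1P: cl => [ci|cl].
  rewrite ci eqxx iJn leqnn andbT /=.
  move: dl; rewrite mem_cat; case/orP => [dl|dJ].
    by have [dt ch] := inl _ dl; rewrite pos_root // ch subnn (negPf (JNl _ dl)).
  by have [dt ch] := inJ _ dJ; rewrite pos_root // ch dJ.
have lt_ic := gti _ cl; rewrite (ltnW lt_ic) andbT.
have -> : (c == i) = false by rewrite -val_eqE gtn_eqF.
have {}cl : c \in l ++ J by [].
move: cl dl; rewrite !mem_cat => /orP[cl|cJ] /orP[dl|dJ].
- have [[ct cc] [dt dc]] := (inl _ cl, inl _ dl).
  rewrite pos_below // cc dc ltnn nl pos_comb // (negPf (JNl _ dl)) andbF.
  by [].
- have [[ct cc] [dt dc]] := (inl _ cl, inJ _ dJ).
  by rewrite pos_below // cc dc ps JNl // dJ.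
- have [[ct cc] [dt dc]] := (inJ _ cJ, inl _ dl).
  by rewrite pos_below // cc dc ps cJ ltnNge (ltnW ps).
- have [[ct cc] [dt dc]] := (inJ _ cJ, inJ _ dJ).
  by rewrite pos_below // cc dc ltnn nJ pos_comb // cJ.
Qed.

Lemma arc_A_prop a k : k \in arc_A a ->
  [/\ arc_i a < k, k < arc_j a, s k != 0 & k \notin arc_B a].
Proof.
move=> kA; have : k \in arc_A a :|: arc_B a by rewrite inE kA.
rewrite arc_cover inE => /andP[/andP[-> ->] ->]; split=> //.
by rewrite (disjointFr (arc_disj a) kA).
Qed.

Lemma arc_B_prop a k : k \in arc_B a ->
  [/\ arc_i a < k, k < arc_j a, s k != 0 & k \notin arc_A a].
Proof.
move=> kB; have : k \in arc_A a :|: arc_B a by rewrite inE kB orbT.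
rewrite arc_cover inE => /andP[/andP[-> ->] ->]; split=> //.
by rewrite (disjointFl (arc_disj a) kB).
Qed.

Lemma arc_AB a k : arc_i a < k -> k < arc_j a -> s k != 0 ->
  (k \in arc_A a) || (k \in arc_B a).
Proof. by move=> ik kj sk; rewrite -in_setU arc_cover inE ik kj sk. Qed.

(** The support of [pos] for the tree of [a]. On it the value depends only on the row, hence the
    separate [arc_val]. *)
Definition arc_rel a c d : bool :=
  [&& c < d, c \in arc_i a |: arc_B a & d \in arc_j a |: arc_A a].

Definition arc_val a c : nat := if c == arc_i a then arc_r a else s c.

Definition arc_pos a c d : nat := if arc_rel a c d then arc_val a c else 0.

Lemma pos_arc a c d : c < d -> pos s (val (stree_of_arc a)) c d = arc_pos a c d.
Proof.
move=> cd /=; rewrite /tree_of_arc /right_comb; set J := _ |: _.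
have Jgt k : k \in J -> arc_i a < k /\ k <= arc_j a.
  case/setU1P=> [->|/arc_A_prop[ik kj _ _]]; last by split=> //; apply: ltnW.
  by split=> //; apply: arc_ltij.
have /andP[r0 rs] := arc_r_range a.
have mem_all k : k \in enum (~: J) ++ enum J by rewrite mem_cat !mem_enum inE orNb.
rewrite pos_graft_comb ?mem_all ?sorted_enum_ord //; first last.
- by apply/allP => k; rewrite mem_enum => /Jgt[].
- by rewrite ltn_subrL r0 (leq_trans r0).
- by rewrite mem_enum inE; apply/negP => /Jgt[]; rewrite ltnn.
- rewrite cat_uniq !enum_uniq andbT; apply/hasPn => k.
  by rewrite /= !mem_enum in_setC negbK.
rewrite !mem_enum subKn // /arc_pos /arc_rel cd -/J /arc_val /= andbC.
have -> : (c \in arc_i a |: arc_B a) = (c == arc_i a) || (c \in arc_B a).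
  by rewrite in_setU1.
case dJ: (d \in J); rewrite ?andbF //= andbT.
have [_ dj] := Jgt _ dJ; case: (eqVneq c (arc_i a)) => [->|ci] /=.
  by rewrite leqnn; case: ifP => // /negbFE /Jgt[]; rewrite ltnn.
case cB: (c \in arc_B a).
  have [ic cj _ cA] := arc_B_prop cB; rewrite (ltnW ic) in_setU1 (negPf cA) orbF.
  by rewrite -val_eqE ltn_eqF.
case: ifP => // /andP[ic]; rewrite in_setU1 => /norP[cj cA].
(* Here [c] lies strictly between the endpoints and outside [arc_A a]; being also outside [arc_B a],
   it must satisfy [s c = 0], so the full value [s c] is still 0. *)
apply/eqP; apply: contraFT cB => sc.
have := arc_AB (a := a) (k := c); rewrite (negPf cA) /=; apply=> //.
  by rewrite ltn_neqAle ic andbT eq_sym.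
exact: leq_trans cd dj.
Qed.

End ArcTrees.

(** * Lower covers of the trees of arcs, and the subarc order *)

Section Forcing.

Variables (n : nat) (s : 'I_n -> nat).
Implicit Types (a b : sarc s) (c d e i j k p q : 'I_n) (x y z t : stree s).

Local Notation "x .p" := (pos s (val x)) (at level 1, format "x .p").
Local Notation T := (@stree_of_arc n s).

Lemma arc_rel_lt a c d : arc_rel a c d -> c < d.
Proof. by case/and3P. Qed.

Lemma arc_rel_ge a c d : arc_rel a c d -> arc_i a <= c.
Proof. by case/and3P => _ /setU1P[->|/arc_B_prop[/ltnW]]. Qed.

Lemma arc_rel_le a c d : arc_rel a c d -> d <= arc_j a.
Proof. by case/and3P => _ _ /setU1P[->|/arc_A_prop[_ /ltnW]]. Qed.

Lemma arc_rel_ij a : arc_rel a (arc_i a) (arc_j a).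
Proof. by rewrite /arc_rel arc_ltij !setU11. Qed.

Lemma arc_val_le a c : arc_val a c <= s c.
Proof.
by rewrite /arc_val; case: eqP => [->|//]; case/andP: (arc_r_range a).
Qed.

Lemma arc_val_gt0 a c : c \in arc_i a |: arc_B a -> 0 < arc_val a c.
Proof.
rewrite /arc_val; case/setU1P => [->|/arc_B_prop[_ _ sc _]].
  by rewrite eqxx; case/andP: (arc_r_range a).
by case: eqP => [_|_]; [case/andP: (arc_r_range a)|rewrite lt0n].
Qed.

Lemma arc_val_B a c : c \in arc_B a -> arc_val a c = s c.
Proof.
by case/arc_B_prop => ic _ _ _; rewrite /arc_val -val_eqE gtn_eqF.
Qed.

Lemma arc_val_i a : arc_val a (arc_i a) = arc_r a.
Proof. by rewrite /arc_val eqxx. Qed.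

Lemma arc_leP a x :
  weak_le (T a) x <-> forall c d, arc_rel a c d -> arc_val a c <= x.p c d.
Proof.
split=> [ax c d cd|ax c d cd].
  by have := ax _ _ (arc_rel_lt cd); rewrite pos_arc ?(arc_rel_lt cd) // /arc_pos cd.
by rewrite pos_arc // /arc_pos; case: ifP => // /ax.
Qed.

Lemma is_pos_arc a : is_pos s (arc_pos a).
Proof.
apply: is_pos_rel => [c|c d e|c d e cd de sd ce]; first exact: arc_val_le.
  (* Two related pairs never compose: the middle label would be both a column and a row of the
     arc. *)
  case/and3P=> _ _ dA /and3P[_ dB _]; case/setU1P: dA dB => [->|dA].
    case/setU1P => [ij|/arc_B_prop[_]]; last by rewrite ltnn.
    by have := arc_ltij a; rewrite ij ltnn.
  have [lt_id _ _ dB] := arc_A_prop dA; case/setU1P => [di|].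
    by move: lt_id; rewrite di ltnn.
  by rewrite (negPf dB).
have := arc_AB (leq_ltn_trans (arc_rel_ge ce) cd) (leq_trans de (arc_rel_le ce)) sd.
case/and3P: ce => _ cB eA /orP[dA|dB].
  by rewrite /arc_rel cd cB in_setU1 dA orbT.
by apply/orP; right; rewrite /arc_rel de eA in_setU1 dB orbT arc_val_B ?eqxx.
Qed.

Definition star_pos a c d : nat :=
  if (c == arc_i a) && (d == arc_j a) then (arc_r a).-1 else arc_pos a c d.

Lemma star_pos_le a c d : star_pos a c d <= arc_pos a c d.
Proof.
rewrite /star_pos; case: ifP => // /andP[/eqP-> /eqP->].
by rewrite /arc_pos arc_rel_ij arc_val_i leq_pred.
Qed.

Lemma arc_pos_gt0 a c d : 0 < arc_pos a c d -> arc_rel a c d.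
Proof. by rewrite /arc_pos; case: ifP. Qed.

(** Only triples involving the corner matter. Transitivity towards the corner would need a middle
    label in both [arc_A a] and [arc_B a]; planarity holds because rows before [arc_i a] and columns
    after [arc_j a] vanish. *)
Lemma is_pos_star a : is_pos s (star_pos a).
Proof.
have [fs fT fP] := is_pos_arc a.
have row0 c d : c < arc_i a -> arc_pos a c d = 0.
  by move=> ci; apply/eqP; rewrite -leqn0 leqNgt; apply/negP
    => /arc_pos_gt0/arc_rel_ge; rewrite leqNgt ci.
split=> [c d|c d e cd de de_gt0|c d e cd de].
- exact: leq_trans (star_pos_le _ _ _) (fs _ _).
- have f_gt0 := leq_trans de_gt0 (star_pos_le _ _ _).
  rewrite {2}/star_pos; case: ifP => [/andP[/eqP ci /eqP ej]|_].
    rewrite {}ci {}ej in cd de f_gt0 *; apply: leq_trans (star_pos_le _ _ _) _.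
    rewrite /arc_pos; case: ifP => // /and3P[_ _ dA].
    case/and3P: (arc_pos_gt0 f_gt0) => _ dB _.
    case/setU1P: dA => [dj|dA]; first by move: de; rewrite dj ltnn.
    have [_ _ _] := arc_A_prop dA; case/setU1P: dB => [di|->//].
    by move: cd; rewrite di ltnn.
  exact: leq_trans (star_pos_le _ _ _) (fT _ _ _ cd de f_gt0).
- rewrite {1}/star_pos; case: ifP => [/andP[/eqP di _] _|_ lt_s].
    by apply: leq_trans (star_pos_le _ _ _) _; rewrite row0 // -di.
  have le_f := fP _ _ _ cd de lt_s; rewrite {2}/star_pos.
  case: ifP => [/andP[/eqP ci /eqP dj]|_].
    apply: leq_trans (star_pos_le _ _ _) _; rewrite /arc_pos.
    by case: ifP => // /arc_rel_le; rewrite -dj leqNgt de.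
  exact: leq_trans (star_pos_le _ _ _) le_f.
Qed.

(* Planarity propagates the value at [(i, j)] to all the pairs of the arc. *)
Lemma arc_le_of_corner a x : weak_le x (T a) -> arc_r a <= x.p (arc_i a) (arc_j a) ->
  x = T a.
Proof.
move=> xa r_le; have [_ _ xP] := is_pos_tree x.
apply: weak_le_anti => //; apply/arc_leP => c d.
have le0 c' d' : c' < d' -> ~~ arc_rel a c' d' -> x.p c' d' = 0.
  move=> cd nr; apply/eqP; rewrite -leqn0.
  by have := xa _ _ cd; rewrite pos_arc // /arc_pos (negPf nr).
have r_gt0 : 0 < arc_r a by case/andP: (arc_r_range a).
have row_i k : k \in arc_j a |: arc_A a -> arc_r a <= x.p (arc_i a) k.
  case/setU1P=> [->//|kA]; have [ik kj sk kB] := arc_A_prop kA.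
  apply: leq_trans r_le _; apply: xP => //; rewrite le0 ?lt0n //.
  rewrite /arc_rel !in_setU1 (negPf kB) -val_eqE.
  by rewrite (gtn_eqF ik) andbF.
case/and3P => cd /setU1P[->|cB] dA; first by rewrite arc_val_i row_i.
have [ic cj sc cA] := arc_B_prop cB; rewrite (arc_val_B cB) leqNgt.
apply/negP => /(xP _ _ _ ic cd); rewrite leqNgt (le0 _ c ic).
  by rewrite (leq_trans r_gt0 (row_i _ dA)).
by rewrite /arc_rel !in_setU1 (negPf cA) -!val_eqE (ltn_eqF cj) !andbF.
Qed.

Lemma stree_eq_or_neq x y : x = y \/ x <> y.
Proof.
have [/forallP eq_xy|/negP ne_xy] :=
  boolP [forall i : 'I_n, [forall j : 'I_n, (i < j) ==> (x.p i j == y.p i j)]].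
  by left; apply: pos_inj => i j ij; apply/eqP/(implyP (forallP (eq_xy i) j)).
right=> xy; apply: ne_xy; rewrite xy.
by apply/forallP => i; apply/forallP => j; rewrite eqxx implybT.
Qed.

(** By [arc_le_of_corner], a tree strictly below that of [a] has a smaller value at the corner,
    hence lies below the tree encoded by [star_pos]. This gives more than a unique lower cover, and
    the last clause records it. *)
Lemma arc_star a : exists t, [/\ is_lower_star (@weak_le n s) (T a) t,
  forall c d, c < d -> t.p c d = star_pos a c d &
  forall x, weak_le x (T a) -> x <> T a -> weak_le x t].
Proof.
have [t tE] := pos_surj (is_pos_star a); exists t.
have r_gt0 : 0 < arc_r a by case/andP: (arc_r_range a).
have ij := arc_ltij a.
have le_t x : weak_le x (T a) -> x <> T a -> weak_le x t.
  move=> xa x_ne c d cd; rewrite tE // /star_pos.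
  case: ifP => [/andP[/eqP-> /eqP->]|_]; last by rewrite -pos_arc // xa.
  rewrite -ltnS prednK // ltnNge; apply/negP => /arc_le_of_corner.
  by move/(_ xa).
have t_le : weak_le t (T a).
  by move=> c d cd; rewrite tE // pos_arc // star_pos_le.
have t_ne : t <> T a.
  move=> ta; have := tE _ _ ij; rewrite ta pos_arc // /arc_pos /star_pos.
  by rewrite arc_rel_ij arc_val_i !eqxx /=; lia.
split=> //; split.
  split=> // -[z [[tz tz_ne] [za za_ne]]]; apply: tz_ne.
  exact: weak_le_anti tz (le_t _ za za_ne).
move=> x [[xa x_ne] no_between]; have xt := le_t _ xa x_ne.
case: (stree_eq_or_neq x t) => [->//|xt_ne].
by case: no_between; exists t; split; split=> // xt_eq; apply: xt_ne; rewrite xt_eq.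
Qed.

Lemma arc_join_irreducible a : join_irreducible (@weak_le n s) (T a).
Proof. by have [t [t_star _ _]] := arc_star a; exists t. Qed.

Lemma lower_star_uniq (S : Type) (le : S -> S -> Prop) u v w :
  is_lower_star le u v -> is_lower_star le u w -> v = w.
Proof. by move=> [_ uv] [uw _]; apply: uv. Qed.

Definition subarcb a b :=
  [&& arc_i b <= arc_i a, arc_j a <= arc_j b, arc_A a \subset arc_A b,
      arc_B a \subset arc_B b, (s (arc_j a) == 0) ==> (arc_j a == arc_j b),
      (arc_i b == arc_i a) ==> (arc_r a == arc_r b) &
      (arc_i b < arc_i a) ==>
        ((arc_i a \in arc_A b) && (arc_r a == 1)) ||
        ((arc_i a \in arc_B b) && (arc_r a == s (arc_i a)))].

Lemma subarcP a b : reflect (subarc a b) (subarcb a b).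
Proof.
apply: (iffP idP).
  case/and5P => ii jj AA BB /and3P[/implyP sj /implyP ri /implyP rl].
  split=> // [/eqP/sj/eqP//|/eqP/ri/eqP//|/rl/orP[/andP[-> /eqP]|/andP[-> /eqP]]].
    by left.
  by right.
case=> -[ii jj] [AA BB] sj ri rl; apply/and5P; split=> //.
apply/and3P; split; first by apply/implyP => /eqP/sj->.
  by apply/implyP => /eqP/ri->.
by apply/implyP => /rl[[-> ->]|[-> ->]]; rewrite !eqxx ?orbT.
Qed.

Lemma subarc_trans a b b' : subarc a b -> subarc b b' -> subarc a b'.
Proof.
move=> [[ii jj] [AA BB] sj ri rl] [[ii' jj'] [AA' BB'] sj' ri' rl'].
split; [by split; lia|by split; apply: subset_trans; eauto| | |].
- by move=> sa; have jE := sj sa; rewrite jE sj' // -jE.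
- move=> iE; have ib : arc_i b = arc_i a by apply: val_inj; move: ii ii'; rewrite iE /=; lia.
  by rewrite ri // ri' // ib.
- case: (ltngtP (arc_i b) (arc_i a)) ii => // [lt_i|/val_inj iE] _ lt_i'.
    case: (rl lt_i) => -[mem_i rE]; [left|right]; split=> //.
      exact: (subsetP AA').
    exact: (subsetP BB').
  by rewrite -iE in lt_i' *; case: (rl' lt_i') => -[mem_i rE]; [left|right];
    rewrite ri // rE.
Qed.

(** The support of [pos] determines the arc: [arc_i] is its least row, [arc_j] its greatest column,
    [arc_A] the other columns of row [arc_i], and [arc_r] the value at the corner. Concluding with
    [subarc] avoids comparing the proof fields of the records. *)
Lemma eq_arc_subarc a b : T a = T b -> subarc a b.
Proof.
move=> ab; have eq_pos c d : c < d -> arc_pos a c d = arc_pos b c d.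
  by move=> cd; rewrite -!pos_arc // ab.
have {ab} eq_rel c d : arc_rel a c d = arc_rel b c d.
  apply/idP/idP => r_cd; have cd := arc_rel_lt r_cd; have := eq_pos _ _ cd;
    rewrite /arc_pos r_cd; case: ifP => // _ v0.
  - by have := @arc_val_gt0 a c; rewrite v0 => /(_ _)/negP; case; case/and3P: r_cd.
  - by have := @arc_val_gt0 b c; rewrite -v0 => /(_ _)/negP; case; case/and3P: r_cd.
have rel_a := arc_rel_ij a; have rel_b := arc_rel_ij b.
have iE : arc_i a = arc_i b.
  apply/val_inj/eqP; rewrite /= eqn_leq.
  rewrite (@arc_rel_ge a _ (arc_j b)) ?eq_rel // (@arc_rel_ge b _ (arc_j a)) //.
  by rewrite -eq_rel.
have jE : arc_j a = arc_j b.
  apply/val_inj/eqP; rewrite /= eqn_leq.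
  rewrite (@arc_rel_le b (arc_i a)) -?eq_rel // (@arc_rel_le a (arc_i b)) //.
  by rewrite eq_rel.
have rE : arc_r a = arc_r b.
  have := eq_pos _ _ (arc_ltij a); rewrite /arc_pos rel_a iE jE rel_b.
  by rewrite arc_val_i -iE arc_val_i.
have AE k : arc_i a < k -> k < arc_j a -> (k \in arc_A a) = (k \in arc_A b).
  move=> ik kj; have := eq_rel (arc_i a) k; rewrite /arc_rel ik !in_setU1 iE jE !eqxx /=.
  by rewrite -val_eqE -jE (ltn_eqF kj).
split; rewrite ?iE ?jE ?ltnn //; split; apply/subsetP => k.
  by move=> kA; have [ik kj _ _] := arc_A_prop kA; rewrite -AE.
move=> kB; have [ik kj sk kA] := arc_B_prop kB.
by have := @arc_AB n s b k; rewrite -iE -jE -AE // (negPf kA) /=; apply.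
Qed.

(** Restricting the two sides of [b] to the open interval between [p] and [q] gives a subarc as soon
    as [q] and [r] meet the endpoint conditions. *)
Lemma subarc_exists b p q r : arc_i b <= p -> p < q -> q <= arc_j b ->
  (s q = 0 -> q = arc_j b) -> (p = arc_i b -> r = arc_r b) ->
  (arc_i b < p -> p \in arc_A b /\ r = 1 \/ p \in arc_B b /\ r = s p) ->
  exists a, [/\ subarc a b, arc_i a = p, arc_j a = q, arc_r a = r &
    (arc_A a = [set k in arc_A b | p < k < q] /\
     arc_B a = [set k in arc_B b | p < k < q])].
Proof.
move=> ip pq qj sq r_i r_gt.
have disj : [disjoint [set k in arc_A b | p < k < q] & [set k in arc_B b | p < k < q]].
  apply: disjointWl (disjointWr _ (arc_disj b)); apply/subsetP => k;
    by rewrite inE => /andP[].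
have cover : [set k in arc_A b | p < k < q] :|: [set k in arc_B b | p < k < q] =
    [set k : 'I_n | p < k < q & s k != 0].
  apply/setP => k; rewrite !inE -andb_orl andbC.
  case pkq: (p < k < q) => //=; rewrite -in_setU arc_cover inE.
  by case/andP: pkq => pk kq; rewrite (leq_ltn_trans ip) // (leq_trans kq).
have r_range : 1 <= r <= s p.
  case: (ltngtP (arc_i b) p) ip => // [lt_ip|/val_inj iE] _.
    case: (r_gt lt_ip) => [[/arc_A_prop[_ _ sp _] ->]|[/arc_B_prop[_ _ sp _] ->]].
      by rewrite /= lt0n.
    by rewrite lt0n sp leqnn.
  by rewrite r_i -?iE // arc_r_range.
exists (SArc pq disj cover r_range); split=> //; split=> //=.
- by split; apply/subsetP => k; rewrite inE => /andP[].
- by move=> iE; apply: r_i.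
Qed.

(** * Arcs below a join *)

Lemma step_connect_le (f : 'I_n -> 'I_n -> nat) d k : connect (step f) d k -> d <= k.
Proof.
case/connectP => w; elim: w d => [|e w IH] d /=; first by move=> _ ->.
by move=> /andP[/andP[/ltnW de _] /IH ew] /ew; apply: leq_trans.
Qed.

Lemma tclosure_attained (f : 'I_n -> 'I_n -> nat) c k m :
  0 < m -> m <= tclosure f c k ->
  exists d, [/\ c < d, connect (step f) d k & m <= f c d].
Proof.
move=> m_gt0 le_m.
have [/existsP[d /and3P[]]|/existsPn none] :=
  boolP [exists d : 'I_n, [&& c < d, connect (step f) d k & m <= f c d]].
  by exists d.
suff : tclosure f c k <= m.-1 by lia.
apply/bigmax_leqP => d /andP[cd dk]; have := none d.
by rewrite cd dk /=; lia.
Qed.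

Section JoinTransfer.

Variables (b : sarc s) (z' : stree s) (c k : 'I_n).
Hypotheses (rel_ck : arc_rel b c k)
  (inner : forall c' k', arc_rel b c' k' -> k' - c' < k - c ->
           arc_val b c' <= z'.p c' k')
  (bad : z'.p c k < arc_val b c).

(** The [arc_r] of a subarc of [b] starting at [p]: it is 1 for [p] in [arc_A b], while at [c], a
    row of [b], it is the full value of that row. *)
Let thr p := if p == c then arc_val b c else 1.

(* [k - c] is minimal among the failures of [weak_le (stree_of_arc b) z'], so
   that, between [c] and [k], [z'] relates [c] exactly to the elements of
   [arc_A b], and exactly the elements of [arc_B b] fully to [k]. An edge of [w]
   across, of minimal length, supports a subarc of [b] that lies below [w] but
   not below [z']. *)
Lemma no_crossing w w' :
  (forall a, subarc a b -> weak_le (T a) w -> weak_le (T a) w') -> weak_le w' z' ->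
  forall p q, p < q -> q <= k -> (p == c) || (c < p) && (p \in arc_A b) ->
    (q == k) || (q \in arc_B b) -> thr p <= w.p p q -> False.
Proof.
move=> ww' w'z'; have [_ _ wP] := is_pos_tree w; have [_ zT _] := is_pos_tree z'.
have [ck cB kA] := and3P rel_ck; have ic := arc_rel_ge rel_ck.
have kj := arc_rel_le rel_ck.
move=> p q; have [m] := ubnP (q - p); elim: m p q => // m IH p q le_m.
move=> pq qk pA qB w_pq.
have cp : c <= p by case/orP: pA => [/eqP->|/andP[/ltnW]].
have thr_gt0 : 0 < thr p by rewrite /thr; case: eqP => // _; apply: arc_val_gt0.
(* Otherwise [(p, e)] would be a shorter crossing. *)
have inB e : p < e -> e < q -> e \in arc_B b -> w.p p e < thr p.
  move=> pe eq eB; rewrite ltnNge; apply/negP => le_e.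
  by apply: (IH p e) => //; rewrite ?eB ?orbT //; lia.
(* Otherwise planarity makes the value of [w] at [(e, q)] at least [s e], hence positive, and
   [(e, q)] is a shorter crossing. *)
have inA e : p < e -> e < q -> e \in arc_A b -> thr p <= w.p p e.
  move=> pe eq eA; rewrite leqNgt; apply/negP => lt_e.
  apply: (IH e q) => //; first by lia.
    by rewrite eA (leq_ltn_trans cp) ?orbT.
  have [_ _ se _] := arc_A_prop eA.
  rewrite /thr -val_eqE gtn_eqF ?(leq_ltn_trans cp) // lt0n.
  apply/eqP => w_eq; have := wP _ _ _ pe eq; rewrite w_eq lt0n => /(_ se).
  by move: w_pq lt_e; lia.
have thr_i : p = arc_i b -> thr p = arc_r b.
  move=> pi; have cE : c = p by apply: val_inj => /=; move: cp ic; rewrite pi; lia.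
  by rewrite /thr -cE eqxx cE pi arc_val_i.
have thr_gt : arc_i b < p ->
    p \in arc_A b /\ thr p = 1 \/ p \in arc_B b /\ thr p = s p.
  rewrite /thr => ip; case: eqP pA => [pc|_] /=; last by case/andP; left.
  move: ip cB; rewrite pc => ic' /setU1P[ci|cB] _.
    by move: ic'; rewrite ci ltnn.
  by right; rewrite (arc_val_B cB).
have sq : s q = 0 -> q = arc_j b.
  case/orP: qB => [/eqP->|/arc_B_prop[_ _ /eqP//]].
  by case/setU1P: kA => // /arc_A_prop[_ _ /eqP].
have [a [ab ai aj ar [aA aB]]] :=
  subarc_exists (leq_trans ic cp) pq (leq_trans qk kj) sq thr_i thr_gt.
have aw : weak_le (T a) w.
  have row_p e : e \in arc_j a |: arc_A a -> thr p <= w.p p e.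
    case/setU1P => [->|]; first by rewrite aj.
    by rewrite aA inE => /and3P[eA pe eq]; apply: inA.
  apply/arc_leP => e d /and3P[ed /setU1P[->|eB] /row_p w_pd].
    by rewrite arc_val_i ar ai.
  rewrite (arc_val_B eB); move: eB; rewrite aB inE => /and3P[eB pe eq].
  rewrite leqNgt; apply/negP => /(wP _ _ _ pe ed).
  by have := inB _ pe eq eB; lia.
have z_pq : thr p <= z'.p p q.
  apply: leq_trans (w'z' _ _ pq); have /arc_leP/(_ p q) := ww' _ ab aw.
  by rewrite -ai -aj arc_rel_ij arc_val_i ar ai; apply.
(* In [z'], the links from [c] to [p] and from [q] to [k] come from [inner], and the link from [p]
   to [q] from the subarc. Transitivity then raises the value at [(c, k)] to [arc_val b c], against
   [bad]. *)
have z_cq : arc_val b c <= z'.p c q.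
  case/orP: pA => [/eqP pc|/andP[cp' pA]].
    by move: z_pq; rewrite /thr pc eqxx.
  apply: leq_trans (zT _ _ _ cp' pq (leq_trans thr_gt0 z_pq)).
  apply: inner; last by lia.
  by rewrite /arc_rel cp' cB in_setU1 pA orbT.
case: (ltngtP q k) qk => // [qk|/val_inj qk] _; last first.
  by move: z_cq bad; rewrite qk; lia.
case/orP: qB => [/eqP qE|qB]; first by move: qk; rewrite qE ltnn.
have z_qk : arc_val b q <= z'.p q k.
  by apply: inner; [rewrite /arc_rel qk kA in_setU1 qB orbT|lia].
have q_gt0 : 0 < arc_val b q by apply: arc_val_gt0; rewrite in_setU1 qB orbT.
have := zT _ _ _ (leq_ltn_trans cp pq) qk (leq_trans q_gt0 z_qk).
by move: z_cq bad; lia.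
Qed.

End JoinTransfer.

(** A value of the join at [(c, k)] comes from a chain of inversions of [x] or [y]. Its inner labels
    have nonzero [s], so they lie in [arc_A b] or [arc_B b]; some step therefore goes from [c] or
    [arc_A b] to [k] or [arc_B b], which [no_crossing] forbids. *)
Lemma arc_le_join b x y z x' y' z' :
  is_join (@weak_le n s) x y z -> is_join (@weak_le n s) x' y' z' ->
  (forall a, subarc a b -> weak_le (T a) x -> weak_le (T a) x') ->
  (forall a, subarc a b -> weak_le (T a) y -> weak_le (T a) y') ->
  weak_le (T b) z -> weak_le (T b) z'.
Proof.
move=> xyz [x'z' y'z' _] xx' yy' /arc_leP bz; apply/arc_leP => c k.
have [m] := ubnP (k - c); elim: m c k => // m IH c k le_m rel_ck.
rewrite leqNgt; apply/negP => bad; have [ck cB kA] := and3P rel_ck.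
have inner c' k' : arc_rel b c' k' -> k' - c' < k - c -> arc_val b c' <= z'.p c' k'.
  by move=> rel' lt'; apply: IH => //; apply: leq_trans lt' _.
have crossing := no_crossing rel_ck inner bad.
have := bz _ _ rel_ck; rewrite (join_pos xyz) //.
set f := pos_max _ _ => /(tclosure_attained (arc_val_gt0 cB))[d [cd dk f_cd]].
have fs e e' : f e e' <= s e by rewrite geq_max !pos_le.
have no_cross p q : p < q -> q <= k -> (p == c) || (c < p) && (p \in arc_A b) ->
    (q == k) || (q \in arc_B b) ->
    (if p == c then arc_val b c else 1) <= f p q -> False.
  move=> pq qk pA qB; rewrite leq_max => /orP[]; first exact: crossing xx' _ _ _ _ _ _ _.
  exact: crossing yy' _ _ _ _ _ _ _.
(* The induction along the chain remembers only the label [p] preceding [d], which is [c] or in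
   [arc_A b]. *)
have {cd f_cd} : exists2 p : 'I_n, p < d &
    ((p == c) || (c < p) && (p \in arc_A b)) /\
    (if p == c then arc_val b c else 1) <= f p d.
  by exists c => //; rewrite eqxx.
case/connectP: dk => w; elim: w d => [|e w IHw] d /=.
  move=> _ <- [p pk [pA f_pk]]; apply: (no_cross p k) => //; exact/orP/or_introl.
move=> /andP[/andP[de f_de] ew] kE [p pd [pA f_pd]].
have ek : e <= k by apply: (@step_connect_le f); apply/connectP; exists w.
have dk := leq_trans de ek.
have cd : c < d by case/orP: pA pd => [/eqP->//|/andP[cp _]]; apply: ltn_trans.
have sd : s d != 0 by rewrite -lt0n (leq_trans f_de).
have id_ := leq_ltn_trans (arc_rel_ge rel_ck) cd.
case/orP: (arc_AB id_ (leq_trans dk (arc_rel_le rel_ck)) sd) => [dA|dB].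
  apply: (IHw e) => //; exists d => //; rewrite dA cd orbT; split=> //.
  by rewrite -val_eqE gtn_eqF.
by apply: (no_cross p d) => //; [apply: ltnW|rewrite dB orbT].
Qed.

End Forcing.

(** * The separator attached to a subarc *)

Section SubarcForces.

Variables (n : nat) (s : 'I_n -> nat) (a b : sarc s).
Hypothesis ab : subarc a b.
Implicit Types (c d e k : 'I_n) (x y z t : stree s).

Local Notation "x .p" := (pos s (val x)) (at level 1, format "x .p").
Local Notation T := (@stree_of_arc n s).
Local Notation p := (arc_i a).
Local Notation q := (arc_j a).

(* The inversions of the tree of [b] that lie on one side of [q], together with
   inversions linking its rows to [p] and [q] to its columns: what is missing is
   only the link from [p] to [q] brought by the tree of [a]. *)
Definition separator_rel c k : bool :=
  (c < k) && ([&& c \in arc_i b |: arc_B b, k \in p |: arc_A b & k < q]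
           || [&& q <= c, c \in q |: arc_B b & k \in arc_j b |: arc_A b]).

Let ip : arc_i b <= p. Proof. by case: ab => -[]. Qed.
Let pq : p < q. Proof. exact: arc_ltij. Qed.
Let qj : q <= arc_j b. Proof. by case: ab => -[]. Qed.

Let p_cases : p = arc_i b /\ arc_r a = arc_r b \/
  arc_i b < p /\ (p \in arc_A b /\ arc_r a = 1 \/ p \in arc_B b /\ arc_r a = s p).
Proof.
case: ab => _ _ _ ri rl; case: (ltngtP (arc_i b) p) ip => // [lt|/val_inj eq] _.
  by right; split=> //; apply: rl.
by left; split=> //; apply: ri.
Qed.

(** Pairs from the two sides of [q] never compose. Within one side, an intermediate label with
    nonzero [s] is a column if it is in [arc_A b], and a row of full value if it is in [arc_B b]. *)
Lemma is_pos_separator :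
  is_pos s (fun c k => if separator_rel c k then arc_val b c else 0).
Proof.
have ge_i c : c \in arc_i b |: arc_B b -> arc_i b <= c.
  by case/setU1P=> [->|/arc_B_prop[/ltnW]].
have le_j c : c \in arc_j b |: arc_A b -> c <= arc_j b.
  by case/setU1P=> [->|/arc_A_prop[_ /ltnW]].
apply: is_pos_rel => [c|c d e|c d e cd de sd].
- exact: arc_val_le.
- case/andP=> cd /orP[/and3P[cB dA dq]|/and3P[qc cB dA]];
    case/andP=> de /orP[/and3P[dB eA eq]|/and3P[qd dB eA]].
  + by rewrite /separator_rel (ltn_trans cd de) cB eA eq.
  + by move: dq; rewrite ltnNge qd.
  + by move: (ltn_trans cd de); rewrite ltnNge (leq_trans (ltnW eq)).
  + rewrite /separator_rel (ltn_trans cd de) qc cB eA orbT.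
    by [].
- case/andP=> ce /orP[/and3P[cB eA eq]|/and3P[qc cB eA]].
    have dq := ltn_trans de eq.
    have id_ := leq_ltn_trans (ge_i _ cB) cd.
    case/orP: (arc_AB id_ (leq_trans dq qj) sd) => [dA|dB].
      by rewrite /separator_rel cd cB in_setU1 dA dq orbT.
    apply/orP; right; rewrite arc_val_B // eqxx andbT.
    by rewrite /separator_rel de eA eq in_setU1 dB orbT.
  have id_ : arc_i b < d by apply: leq_ltn_trans ip (ltn_trans (leq_trans pq qc) cd).
  case/orP: (arc_AB id_ (leq_trans de (le_j _ eA)) sd) => [dA|dB].
    by rewrite /separator_rel cd qc cB [d \in arc_j b |: _]in_setU1 dA !orbT.
  apply/orP; right; rewrite arc_val_B // eqxx andbT.
  rewrite /separator_rel de eA (leq_trans qc (ltnW cd)).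
  by rewrite [d \in q |: _]in_setU1 dB !orbT.
Qed.

Variable x : stree s.
Hypothesis xE : forall c d, c < d ->
  x.p c d = if separator_rel c d then arc_val b c else 0.

(** Only pairs with [c < q <= k] need the tree of [a]. The row of [c] reaches [q] through [p] if
    [c < p], and directly by the tree of [a] if [p <= c]; the separator then leads from [q] to
    [k]. *)
Lemma arc_le_separator_join z : weak_le (T a) z -> weak_le x z -> weak_le (T b) z.
Proof.
move=> /arc_leP az xz; have [_ zT _] := is_pos_tree z; apply/arc_leP => c k rel_ck.
have sep_le c' k' : separator_rel c' k' -> arc_val b c' <= z.p c' k'.
  move=> sep; have lt' : c' < k' by case/andP: sep.
  by have := xz _ _ lt'; rewrite xE // sep.
have [ck cB kA] := and3P rel_ck; have kj := arc_rel_le rel_ck.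
case: (ltnP k q) => [kq|qk].
  by apply: sep_le; rewrite /separator_rel ck cB kq [k \in p |: _]in_setU1;
    case/setU1P: kA kq => [->|->]; rewrite ?orbT // ltnNge qj.
case: (leqP q c) => [qc|cq].
  apply: sep_le; rewrite /separator_rel ck qc kA andbT [c \in q |: _]in_setU1.
  case/setU1P: cB qc => [->|->]; last by rewrite !orbT.
  by rewrite leqNgt (leq_ltn_trans ip pq).
have z_pq : arc_r a <= z.p p q by rewrite -arc_val_i; apply/az/arc_rel_ij.
have r_gt0 : 0 < arc_r a by case/andP: (arc_r_range a).
have z_cq : arc_val b c <= z.p c q.
  case: (ltngtP c p) => [cp|pc|/val_inj cp].
  - apply: leq_trans (zT _ _ _ cp pq (leq_trans r_gt0 z_pq)).
    by apply: sep_le; rewrite /separator_rel cp cB setU11 pq.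
  - have cBb : c \in arc_B b.
      by case/setU1P: cB pc => // ->; rewrite ltnNge ip.
    have [_ _ sc cA] := arc_B_prop cBb.
    have cBa : c \in arc_B a.
      case/orP: (arc_AB pc cq sc) => // cAa; case: ab => _ [/subsetP/(_ _ cAa)].
      by rewrite (negPf cA).
    rewrite (arc_val_B cBb) -(arc_val_B cBa); apply: az.
    by rewrite /arc_rel cq setU11 in_setU1 cBa orbT.
  - rewrite cp; apply: leq_trans z_pq.
    case: p_cases => [[-> ->]|[lt_ip [[pA _]|[pB ->]]]]; last exact: arc_val_le.
      by rewrite arc_val_i.
    move: cB; rewrite cp => /setU1P[pi|/arc_B_prop[_ _ _]]; last by rewrite pA.
    by move: lt_ip; rewrite pi ltnn.
case: (ltngtP q k) qk => // [qk|/val_inj <-//] _.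
apply: leq_trans z_cq _; apply: zT => //.
have qj_lt := leq_trans qk kj.
(* Since [q] is not the right end of [b], the subarc condition on [s q] makes row [q] of the
   separator positive. *)
have sq : s q != 0.
  by apply/eqP => sq; case: ab => _ _ /(_ sq) qE; move: qj_lt; rewrite qE ltnn.
have : arc_val b q <= z.p q k.
  apply: sep_le; rewrite /separator_rel qk leqnn setU11 kA.
  by rewrite orbT.
rewrite /arc_val -val_eqE gtn_eqF ?(leq_ltn_trans ip pq) //.
by apply: leq_trans; rewrite lt0n.
Qed.

(** A chain realizing the value at [(c0, arc_j b)] would have to pass [q], but it stays among the
    labels of [arc_A b] below [q]: the only possible exit is the corner of [a], whose lowered value
    is too small. *)
Lemma not_arc_le_separator_join t z : is_lower_star (@weak_le n s) (T a) t ->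
  is_join (@weak_le n s) t x z -> ~ weak_le (T b) z.
Proof.
move=> t_star txz /arc_leP bz; have [t' [t'_star t'E _]] := arc_star a.
rewrite -(lower_star_uniq t_star t'_star) in t'E.
(* The row where the loss at the corner shows: [p] itself when it is a row of [b], and [arc_i b]
   when [p] is in [arc_A b]. *)
pose c0 := if p \in arc_B b then p else arc_i b.
have c0B : c0 \in arc_i b |: arc_B b.
  by rewrite /c0; case: ifP => [pB|_]; rewrite in_setU1 ?pB ?eqxx ?orbT.
have c0p : c0 <= p by rewrite /c0; case: ifP.
have c0j : c0 < arc_j b by apply: leq_trans qj; apply: leq_ltn_trans pq.
have := bz c0 (arc_j b); rewrite /arc_rel c0j c0B setU11 => /(_ isT).
rewrite (join_pos txz) //; set f := pos_max _ _.
move=> /(tclosure_attained (arc_val_gt0 c0B))[d [cd dj f_cd]].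
have v_gt0 := arc_val_gt0 c0B.
have star_in e : 0 < star_pos a p e -> (e == q) || (e \in arc_A b) && (e < q).
  move=> /leq_trans/(_ (star_pos_le _ _ _))/arc_pos_gt0/and3P[_ _ /setU1P[->|eA]].
    by rewrite eqxx.
  have [_ -> _ _] := arc_A_prop eA; case: ab => _ [/subsetP/(_ _ eA)-> _] _ _ _.
  by rewrite orbT.
have c0_eq_i : p \in arc_A b -> c0 = arc_i b.
  by move=> /arc_A_prop[_ _ _ pB]; rewrite /c0 (negPf pB).
(* The first step must carry all of [arc_val b c0]. If it starts at [p], that value is [arc_r a], so
   the corner with one unit less does not suffice. *)
have {cd f_cd} dA : (d \in arc_A b) && (d < q).
  move: f_cd; rewrite leq_max t'E // xE // => /orP[v_star|].
    have := leq_trans v_gt0 (leq_trans v_star (star_pos_le _ _ _)).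
    move=> /arc_pos_gt0/arc_rel_ge pc0.
    have c0E : c0 = p by apply/val_inj/eqP; rewrite eqn_leq c0p.
    rewrite c0E in v_star v_gt0; case/orP: (star_in _ (leq_trans v_gt0 v_star)) => // /eqP dq.
    move: v_star; rewrite dq /star_pos !eqxx /=.
    have r_gt0 : 0 < arc_r a by case/andP: (arc_r_range a).
    have -> : arc_val b p = arc_r a.
      case: p_cases => [[pi ->]|[lt_ip [[/c0_eq_i c0i _]|[pB ->]]]].
      - by rewrite pi arc_val_i.
      - by move: lt_ip; rewrite -c0i c0E ltnn.
      - exact: arc_val_B.
    by rewrite leqNgt prednK ?leqnn.
  case: ifP => [/andP[_ /orP[/and3P[_ dA dq]|/and3P[qc0 _ _]]] _|_].
  - rewrite dq andbT; case/setU1P: dA => // dp; rewrite dp in cd.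
    case: p_cases => [[pi _]|[_ [[pA _]|[pB _]]]]; last 2 first.
    - by rewrite dp.
    - by move: cd; rewrite /c0 pB ltnn.
    by move: cd; rewrite pi /c0; case: ifP => _; rewrite ?pi ltnn.
  - by move: (leq_trans pq qc0); rewrite ltnNge c0p.
  - by rewrite leqNgt v_gt0.
case/connectP: dj => w; elim: w d dA => [|e w IH] d /= /andP[dA dq].
  by move=> _ jd; move: dq; rewrite -jd ltnNge qj.
case/andP=> /andP[de f_de] ew jE; apply: IH ew jE.
(* A later step starts in [arc_A b], where the separator has no row below [q] and the lower cover of
   [a] has at most row [p]. In that case [arc_r a = 1], so the lowered corner is 0. *)
have [id_ _ _ dB] := arc_A_prop dA.
move: f_de; rewrite leq_max t'E // xE // => /orP[star_gt0|].
  have /and3P[_ dpB _] := arc_pos_gt0 (leq_trans star_gt0 (star_pos_le _ _ _)).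
  have dp : d = p.
    case/setU1P: dpB => // dBa; case: ab => _ [_ /subsetP/(_ _ dBa)].
    by rewrite (negPf dB).
  rewrite dp in star_gt0 id_ dA dB; case/orP: (star_in _ star_gt0) => // /eqP eq.
  move: star_gt0; rewrite eq /star_pos !eqxx /=.
  case: p_cases => [[pi _]|[_ [[_ ->]|[pB _]]]] //.
    by move: id_; rewrite pi ltnn.
  by move: dB; rewrite pB.
case: ifP => // /andP[_ /orP[/and3P[dB' _ _]|/and3P[qd _ _]]] _.
  case/setU1P: dB' => [di|]; last by rewrite (negPf dB).
  by move: id_; rewrite di ltnn.
by move: dq; rewrite ltnNge qd.
Qed.

End SubarcForces.

(** * Comparison of forcing with the subarc order *)

Section ForcingIsSubarc.

Variables (n : nat) (s : 'I_n -> nat).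
Implicit Types (a b : sarc s) (x y z : stree s).

Local Notation le := (@weak_le n s).
Local Notation T := (@stree_of_arc n s).

Lemma weak_le_refl x : le x x. Proof. by move=> i j _. Qed.

Lemma weak_le_trans y x z : le x y -> le y z -> le x z.
Proof. by move=> xy yz i j ij; apply: leq_trans (xy _ _ ij) (yz _ _ ij). Qed.

Lemma subarc_forces a b : subarc a b -> forces le (T a) (T b).
Proof.
move=> ab; split; [exact: arc_join_irreducible|exact: arc_join_irreducible|].
move=> R [Rrefl Rsym Rtrans Rjoin Rmeet] [t t_star Rat].
have [x xE] := pos_surj (is_pos_separator ab).
have [z az _] := join_exists (T a) x; have [z' tz _] := join_exists t x.
have bz : le (T b) z by case: az => ? ? _; apply: (arc_le_separator_join ab xE).
have nbz' := not_arc_le_separator_join ab xE t_star tz.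
have [y by_] := meet_exists (T b) z'; have [yb yz' _] := by_.
have Rzz' : R z z' by apply: Rjoin az tz.
have bmeet : is_meet le (T b) z (T b) by split=> //; apply: weak_le_refl.
have Rby : R (T b) y by apply: Rmeet Rzz' bmeet by_.
have [u [u_star _ u_max]] := arc_star b; exists u => //.
have yu : le y u by apply: u_max => // yE; apply: nbz'; rewrite -yE.
have ub : le u (T b) by case: u_star => -[[]].
(* As [y] is below [u] and [u] below the tree of [b], joining with [u] turns the equivalence of that
   tree with [y] into one with [u]. *)
have bu : is_join le (T b) u (T b) by split=> //; apply: weak_le_refl.
have yu_join : is_join le y u u by split=> //; apply: weak_le_refl.
exact: Rjoin Rby (Rrefl u) bu yu_join.
Qed.

(* The congruence generated by the contraction of [a]. *)
Definition arc_cong a x y := forall b, ~~ subarcb a b -> le (T b) x <-> le (T b) y.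

(** If [a] is not a subarc of [b], then by transitivity it is not a subarc of any subarc of [b], so
    [arc_le_join] applies. Meets are immediate, since lying below a meet means lying below both
    elements. *)
Lemma congruence_arc_cong a : congruence le (arc_cong a).
Proof.
have half x x' y y' z z' : arc_cong a x x' -> arc_cong a y y' ->
    is_join le x y z -> is_join le x' y' z' ->
    forall b, ~~ subarcb a b -> le (T b) z -> le (T b) z'.
  move=> xx' yy' xyz xyz' b ab.
  have sub_ab b' : subarc b' b -> ~~ subarcb a b'.
    move=> b'b; apply: contra ab => /subarcP ab'; apply/subarcP.
    exact: subarc_trans ab' b'b.
  by apply: (arc_le_join xyz xyz') => b' /sub_ab ab' le_b'; [apply/(xx' b')|apply/(yy' b')].
split=> [x b _|x y xy b ab|x y z xy yz b ab||].
- by [].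
- exact: iff_sym (xy b ab).
- exact: iff_trans (xy b ab) (yz b ab).
- move=> x x' y y' z z' xx' yy' xyz xyz' b ab; split; first exact: half xyz xyz' b ab.
  have cong_sym u v : arc_cong a u v -> arc_cong a v u.
    by move=> uv b' ab'; apply: iff_sym (uv b' ab').
  exact: half (cong_sym _ _ xx') (cong_sym _ _ yy') xyz' xyz b ab.
- move=> x x' y y' z z' xx' yy' [zx zy z_max] [zx' zy' z_max'] b ab.
  split=> le_b; [apply: z_max'|apply: z_max].
  + by apply/(xx' b ab); apply: weak_le_trans zx.
  + by apply/(yy' b ab); apply: weak_le_trans zy.
  + by apply/(xx' b ab); apply: weak_le_trans zx'.
  + by apply/(yy' b ab); apply: weak_le_trans zy'.
Qed.

Lemma contracted_arc_cong a : contracted le (arc_cong a) (T a).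
Proof.
have [t [t_star _ t_max]] := arc_star a; exists t => // b ab.
have ta : le t (T a) by case: t_star => -[[]].
split=> [ba|bt]; last exact: weak_le_trans ta.
by apply: t_max => // ba_eq; case/negP: ab; apply/subarcP/eq_arc_subarc.
Qed.

(** Otherwise [b] itself is a test arc, and its tree would lie below its own lower cover. *)
Lemma contracted_arc_cong_subarc a b : contracted le (arc_cong a) (T b) -> subarc a b.
Proof.
case=> t [[[tb t_ne] _] _] Rbt; apply/subarcP/negPn/negP => /Rbt[+ _].
by move=> /(_ (@weak_le_refl _)) bt; apply: t_ne; apply: weak_le_anti.
Qed.

End ForcingIsSubarc.

Theorem theorem72 (n : nat) (hn : 1 <= n) (s : 'I_n -> nat) (a a' : sarc s) :
  forces (@weak_le n s) (stree_of_arc a) (stree_of_arc a') <-> subarc a a'.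
Proof.
split=> [[_ _ forced]|]; last exact: subarc_forces.
exact/contracted_arc_cong_subarc/forced/contracted_arc_cong/congruence_arc_cong.
Qed.
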